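(* Let $m,\delta\in\mathbb N=\{1,2,\ldots\}$. Consider additive sink subtraction with subtraction set $S(m,\delta)=\{m,\;m+\delta,\;2m+\delta\}$, and let $d$ be the residue of $\delta$ modulo $2m$ with $0\le d<2m$. Then the sequence of nim-values $(v(x))_{x\ge 1}$ is purely periodic, with period length $$p(m,\delta)=\begin{cases}3m+2\delta-d, & \text{if } 0\le d\le m,\\[2pt] \dfrac{m(m+2\delta+d)}{\gcd(m,d)}, & \text{otherwise (i.e. if } m<d<2m).\end{cases}$$
   Context: Sink subtraction with finite subtraction set $S\subset\mathbb N$ is the following two-player impartial game under normal play (a player who cannot move loses). Positions are integers. Every non-positive integer is terminal (these positions form the ''sink''; no move is possible from them). From any position $x\ge 1$, for every $s\in S$, the position $x-s\in\mathbb Z$ is an option (moves to non-positive integers are allowed). The nim-value is defined by $v(x)=0$ for all $x\le 0$, and $v(x)=\mathrm{mex}\{v(x-s): s\in S\}$ for $x\ge 1$, where $\mathrm{mex}\,X=\min(\mathbb N_0\setminus X)$ for finite $X\subset\mathbb N_0=\mathbb N\cup\{0\}$. The nim-sequence is $v(1),v(2),v(3),\ldots$ (it starts at $x=1$). The sequence $(v(x))_{x\ge1}$ is purely periodic with period length $p\ge 1$ if $v(x+p)=v(x)$ for all $x\ge 1$ and $p$ is the least positive integer with this property. *)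

(* Defs.v *)
From HB Require Import structures.
From mathcomp Require Import all_boot all_order all_algebra.
From mathcomp Require Import zify.

Set Implicit Arguments.
Unset Strict Implicit.
Unset Printing Implicit Defensive.

Import Order.TTheory GRing.Theory Num.Theory.
Local Open Scope ring_scope.

Lemma exists_notin (X : seq nat) : exists n : nat, n \notin X.
Proof.
exists (\max_(i <- X) i).+1; apply/negP => inX.
suff: ((\max_(i <- X) i).+1 <= \max_(i <- X) i)%N by rewrite ltnn.
exact: (@leq_bigmax_seq _ X xpredT (fun i => i)).
Qed.

Definition mex (X : seq nat) : nat := ex_minn (exists_notin X).

Definition options (S : seq nat) (x : int) : seq int :=
  if 0 < x then [seq x - s%:Z | s <- S] else [::].

(* The fuel k bounds the number of moves; a play from x lasts at most `|x|
   moves when every s in S is positive, so nim_value does not run out of fuel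
   (see nim_valueE). *)
Fixpoint nim_value_rec (S : seq nat) (k : nat) (x : int) : nat :=
  if k is k'.+1 then mex [seq nim_value_rec S k' y | y <- options S x] else 0%N.

Definition nim_value (S : seq nat) (x : int) : nat := nim_value_rec S `|x|%N x.

Lemma mex_nil : mex [::] = 0%N.
Proof. by rewrite /mex; case: ex_minnP => n _ /(_ 0%N isT); case: n. Qed.

Lemma nim_value_sink (S : seq nat) (x : int) : x <= 0 -> nim_value S x = 0%N.
Proof.
move=> x_le0; rewrite /nim_value; case: `|x|%N => //= k.
by rewrite /options ltNge x_le0 /= mex_nil.
Qed.

Lemma nim_value_rec_stable (S : seq nat) (k l : nat) (x : int) :
  0%N \notin S -> x <= k%:Z -> x <= l%:Z ->
  nim_value_rec S k x = nim_value_rec S l x.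
Proof.
move=> S0; have sink j y : y <= 0 -> nim_value_rec S j y = 0%N.
  by case: j => //= j y_le0; rewrite /options ltNge y_le0 /= mex_nil.
elim: k l x => [|k IHk] [|l] x xk xl; [by [] | by rewrite [RHS]sink | by rewrite [LHS]sink | ].
rewrite /= /options; case: ltP => // x_gt0.
rewrite -!map_comp; congr mex; apply/eq_in_map => s sS /=.
have s_gt0 : (0 < s)%N by rewrite lt0n; apply: contraNneq S0 => <-.
apply: IHk; lia.
Qed.

Lemma nim_valueE (S : seq nat) (x : int) :
  0%N \notin S -> 1 <= x ->
  nim_value S x = mex [seq nim_value S (x - s%:Z) | s <- S].
Proof.
move=> S0 x_ge1; rewrite /nim_value.
have [k xE] : exists k, `|x|%N = k.+1 by exists `|x|%N.-1; lia.
rewrite {1}xE /= /options ifT; last by lia.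
rewrite -map_comp; congr mex; apply/eq_in_map => s sS /=.
have s_gt0 : (0 < s)%N by rewrite lt0n; apply: contraNneq S0 => <-.
apply: nim_value_rec_stable => //; lia.
Qed.

Definition is_period (v : int -> nat) (p : nat) : Prop :=
  (0 < p)%N /\ forall x : int, 1 <= x -> v (x + p%:Z) = v x.

Definition purely_periodic_with_length (v : int -> nat) (p : nat) : Prop :=
  is_period v p /\ forall q : nat, is_period v q -> (p <= q)%N.

Definition additive_set (m delta : nat) : seq nat :=
  [:: m; m + delta; 2 * m + delta]%N.

(* Main.v *)
(* Put b = m + delta and u y = v (y + 1), so that the subtraction set is
   {m, b, m + b}.

   If d <= m, write b = 2 Q m + c with -m <= c <= 0; the nim-sequence repeats
     (1^m 2^m)^Q 3^(m+c) 0^m (3^m 0^m)^(Q-1).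
   If m < d, write b = 2 Q m + c with 0 < c < m; the nim-sequence is a
   concatenation of rows W(e_k) with e_k = k c mod m, where W(e) is
     1^(m-e) 0^e 2^(m-e) (1^m 2^m)^(Q-1) 1^(c+e)
     3^(m-c-e) 2^(c+e) 0^(m-e) (3^m 0^m)^(Q-1) 3^(c+e)
   if e + c < m (length 2 b), and, with f = e + c - m >= 0,
     1^(m-e) 0^e 2^(m-e) (1^m 2^m)^Q 1^f
     0^(m-e) 3^(e-f) 2^f 3^(m-e) 0^m (3^m 0^m)^(Q-1) 3^f
   otherwise (length 2 b + m). The offset e_k first returns to 0 after
   m / gcd(m, c) rows, which yields the period. It is the least one because a
   value 0 is immediately followed by a value 1 only where a row with e = 0
   starts. *)

Require Import Defs.
From HB Require Import structures.
From mathcomp Require Import all_boot all_order all_algebra.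
From mathcomp Require Import zify.

Set Implicit Arguments.
Unset Strict Implicit.
Unset Printing Implicit Defensive.

Import Order.TTheory GRing.Theory Num.Theory.
Local Open Scope ring_scope.

(** * Mex of three values, and the recurrence on the integers *)

(** Unlike [mex], a minimum extracted from an existence proof, this case analysis reduces once the
    three values are known. *)
Definition mex3 (x y z : nat) : nat :=
  if 0%N \notin [:: x; y; z] then 0%N
  else if 1%N \notin [:: x; y; z] then 1%N
  else if 2%N \notin [:: x; y; z] then 2%N else 3%N.

Lemma mexP (X : seq nat) (n : nat) :
  n \notin X -> (forall k, (k < n)%N -> k \in X) -> mex X = n.
Proof.
move=> nX ltX; rewrite /mex; case: ex_minnP => j jX jmin.
apply/eqP; rewrite eqn_leq jmin // leqNgt.
by apply/negP => /ltX; rewrite (negbTE jX).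
Qed.

Lemma mex3E (x y z : nat) : mex [:: x; y; z] = mex3 x y z.
Proof.
rewrite /mex3; have [x0|/negPn x0] := boolP (0%N \notin _); first exact: mexP.
have [x1|/negPn x1] := boolP (1%N \notin _); first by apply: mexP => // -[].
have [x2|/negPn x2] := boolP (2%N \notin _); first by apply: mexP => // -[|[]].
apply: mexP => [|[|[|[]]] //]; move: x0 x1 x2; rewrite !inE; lia.
Qed.

Definition additive_nim (u : int -> nat) (m b : int) : Prop :=
  (forall y : int, y < 0 -> u y = 0%N) /\
  (forall y : int, 0 <= y -> u y = mex3 (u (y - m)) (u (y - b)) (u (y - m - b))).

(* What the row computation needs to know about the m + b values preceding a
   row W(e) that starts at X. The conditions leave some values undetermined, so
   that they hold after either kind of row and also after the sink (with e = 0). *)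
Definition row_start (u : int -> nat) (m b X e : int) : Prop :=
  [/\ forall y : int, X - m <= y < X - e -> u y = 0%N,
      forall y : int, X - e <= y < X -> u y = 3%N,
      forall y : int, X - b <= y < X - b + m - e -> u y = 0%N \/ u y = 3%N
    & forall y : int, X - b + m - e <= y < X - b + m -> u y = 2%N] /\
  [/\ forall y : int, X - b - m <= y < X - b - e -> u y <> 1%N,
      forall y : int, X - b - e <= y < X - b -> u y <> 0%N,
      forall y : int, X - b + m <= y < X -> u y = 0%N \/ u y = 3%N
    & forall y : int, X - b + m <= y < X -> y < X - b + 2 * m - e \/ X - b + 2 * m <= y ->
        u y = 0%N \/ u (y - m) = 0%N].

(** * Alternating blocks of length [m] *)

(** The recurrence gives the swap of [v] and [3 - v] only if the value [m] steps back is already one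
    of the two. This induction discharges that proviso, which makes [alternate] applicable. *)
Lemma alternate_range (u : int -> nat) (m L R : int) (v : nat) :
  0 < m -> (v <= 3)%N ->
  (forall y : int, L <= y < L + m -> y < R -> u y = v) ->
  (forall y : int, L + m <= y < R -> u (y - m) = v \/ u (y - m) = (3 - v)%N ->
     (u y + u (y - m)%R)%N = 3%N) ->
  forall y : int, L <= y < R -> u y = v \/ u y = (3 - v)%N.
Proof.
move=> m0 v3 base flip.
suff H (n : nat) (y : int) : L <= y < R -> y < L + n%:Z -> u y = v \/ u y = (3 - v)%N.
  by move=> y hy; apply: (H (absz (y - L + 1))) => //; lia.
elim: n y => [|n IH] y hy yn; first lia.
have := base y; have := flip y; have := IH (y - m); lia.
Qed.

(** A step of length [m] swaps [v] and [3 - v], so two steps reproduce the first block; [R] may cut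
    a block short. It is used with [v = 1] for the runs of 1 and 2, and with [v = 0] or [v = 3] for
    those of 0 and 3. *)
Lemma alternate (u : int -> nat) (m L R : int) (v : nat) :
  0 < m -> (v <= 3)%N ->
  (forall y : int, L <= y < L + m -> y < R -> u y = v) ->
  (forall y : int, L + m <= y < R -> (u y + u (y - m)%R)%N = 3%N) ->
  forall (q : nat) (y : int), y < R ->
    (L + 2 * m * q%:Z <= y < L + 2 * m * q%:Z + m -> u y = v) /\
    (L + 2 * m * q%:Z + m <= y < L + 2 * m * q%:Z + 2 * m -> u y = (3 - v)%N).
Proof.
move=> m0 v3 base flip.
have mq (q : nat) : 0 <= m * q%:Z by rewrite mulr_ge0 //; lia.
have second q : (forall y : int, y < R -> L + 2 * m * q%:Z <= y < L + 2 * m * q%:Z + m -> u y = v) ->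
  forall y : int, y < R -> L + 2 * m * q%:Z + m <= y < L + 2 * m * q%:Z + 2 * m -> u y = (3 - v)%N.
  move=> first y yR hy; have := flip y; have := first (y - m); have := mq q; lia.
have first q : forall y : int, y < R -> L + 2 * m * q%:Z <= y < L + 2 * m * q%:Z + m -> u y = v.
  elim: q => [|q /second IH] y yR hy; first by apply: base; lia.
  have := flip y; have := IH (y - m); have := mq q; lia.
by move=> q y yR; split=> hy; [apply: first hy | apply: second hy => //; apply: first].
Qed.

(** * Values inside one row *)

(** For [y < X + b] the options [y - b] and [y - m - b] lie before [X], where [row_start] controls
    them. From [X + m] on, outside one short interval, both have value 0 or 3 and at least one has
    value 0, so the mex swaps 1 and 2. *)
Lemma row_first_half (u : int -> nat) (m b X e : int) :
  additive_nim u m b -> 0 < m -> m <= b -> 0 <= X -> 0 <= e < m ->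
  row_start u m b X e ->
  [/\ forall y : int, X <= y < X + m - e -> u y = 1%N,
      forall y : int, X + m - e <= y < X + m -> u y = 0%N,
      forall y : int, X + m <= y < X + 2 * m - e -> y < X + b -> u y = 2%N,
      forall y : int, X + 2 * m - e <= y < X + 3 * m - e -> y < X + b -> u y = 1%N
    & forall y : int, X + 3 * m - e <= y < X + b -> u (y - m) = 1%N \/ u (y - m) = 2%N ->
       (u y + u (y - m)%R)%N = 3%N].
Proof.
move=> [_ rec] m0 mb X0 he [[p1 p2 p3 p4] [p5 p6 p7 p8]].
have subC (y : int) : y - m - b = y - b - m by lia.
have F1 (y : int) : X <= y < X + m - e -> u y = 1%N.
  move=> hy; rewrite rec; last by lia.
  rewrite (p1 (y - m)); last by lia.
  have := p5 (y - m - b) ltac:(lia).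
  by case: (p3 (y - b) ltac:(lia)) => ->; case: (u _) => [|[|[|?]]].
have F2 (y : int) : X + m - e <= y < X + m -> u y = 0%N.
  move=> hy; rewrite rec; last by lia.
  rewrite (p2 (y - m)) ?(p4 (y - b)); try by lia.
  by have := p6 (y - m - b) ltac:(lia); case: (u _).
have F3 (y : int) : X + m <= y < X + 2 * m - e -> y < X + b -> u y = 2%N.
  move=> hy yb; rewrite rec ?subC; last by lia.
  rewrite (F1 (y - m)); last by lia.
  case: (p7 (y - b) ltac:(lia)) (p3 (y - b - m) ltac:(lia))
    (p8 (y - b) ltac:(lia) ltac:(lia)) => -> [] -> //; lia.
have F4 (y : int) : X + 2 * m - e <= y < X + 3 * m - e -> y < X + b -> u y = 1%N.
  move=> hy yb; rewrite rec ?subC; last by lia.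
  (* Here [y - b] lies in the gap left by the last condition of [row_start]; the options have values
     0, 2 and one of 0, 3. *)
  have [y2|y2] := ltP y (X + 2 * m).
    rewrite (F2 (y - m)) ?(p4 (y - b - m)); try by lia.
    by case: (p7 (y - b) ltac:(lia)) => ->.
  rewrite (F3 (y - m)); try by lia.
  case: (p7 (y - b) ltac:(lia)) (p7 (y - b - m) ltac:(lia))
    (p8 (y - b) ltac:(lia) ltac:(lia)) => -> [] -> //; lia.
split=> // y hy um; rewrite rec ?subC; last by lia.
case: um => ->; case: (p7 (y - b) ltac:(lia)) (p7 (y - b - m) ltac:(lia))
    (p8 (y - b) ltac:(lia) ltac:(lia)) => -> [] -> //; lia.
Qed.

(** Here [q] is Q - 1. The alternation of 1 and 2 reaches [X + b] inside a block of 1s, of which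
    [e + c < m] entries fit. From [X + b + m] on, the entries [b] steps back turn from 1, 2 into 3,
    0. *)
Lemma row_start_next_lt (u : int -> nat) (m b c X e : int) (q : nat) :
  additive_nim u m b -> 0 < c < m -> b = 2 * m * q%:Z + 2 * m + c ->
  0 <= X -> 0 <= e -> e + c < m -> row_start u m b X e ->
  row_start u m b (X + 2 * b) (e + c) /\
  (forall y : int, X < y < X + 2 * b -> u y = 1%N -> u (y - 1) <> 0%N).
Proof.
move=> nim_u hc bE X0 e0 ec st.
have mq : 0 <= m * q%:Z by rewrite mulr_ge0 //; lia.
have [F1 F2 F3 F4 F5] := row_first_half (e := e) nim_u ltac:(lia) ltac:(lia) X0 ltac:(lia) st.
have subC (y : int) : y - m - b = y - b - m by lia.
case: nim_u st => _ rec [[p1 p2 _ _] _].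
have FR (y : int) : X + 2 * m - e <= y < X + b -> u y = 1%N \/ u y = 2%N.
  move=> hy; apply: (@alternate_range u m (X + 2 * m - e) (X + b) 1%N) => // [|z hz zR|z hz um].
  - by lia.
  - by apply: F4; lia.
  by apply: F5 => //; lia.
have {}F5 (y : int) : X + 3 * m - e <= y < X + b -> (u y + u (y - m)%R)%N = 3%N.
  by move=> hy; apply: F5 => //; apply: FR; lia.
have FA := @alternate u m (X + 2 * m - e) (X + b) 1%N ltac:(lia) isT
  ltac:(by move=> *; apply: F4; lia) ltac:(by move=> *; apply: F5; lia).
(* Block number [q] starts at [X + 2 * m - e + 2 * m * q], which is [X + b - e - c]. *)
have E1 (y : int) : X + b - e - c <= y < X + b -> u y = 1%N.
  by move=> hy; apply: (FA q y _).1; lia.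
have E2 (y : int) : X + b - m <= y < X + b - e - c -> u y = 2%N.
  (* For [q = 0] the preceding 2s are the run starting at [X + m], before the alternation used in
     [FA]. *)
  case: q bE mq FA {E1} => [|k] bE mq FA hy; first by apply: F3; lia.
  by apply: (FA k y _).2; lia.
have G1 (y : int) : X + b <= y < X + b + m - e - c -> u y = 3%N.
  move=> hy; rewrite rec; last by lia.
  by rewrite (E2 (y - m)) ?(F1 (y - b)) ?(p1 (y - m - b)) //; lia.
have G2 (y : int) : X + b + m - e - c <= y < X + b + m -> u y = 2%N.
  move=> hy; rewrite rec; last by lia.
  rewrite (E1 (y - m)); last by lia.
  have [yl|yl] := ltP y (X + b + m - e).
    by rewrite (F1 (y - b)) ?(p1 (y - m - b)) //; lia.
  by rewrite (F2 (y - b)) ?(p2 (y - m - b)) //; lia.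
have G3 (y : int) : X + b + m <= y < X + b + 2 * m - e -> u y = 0%N.
  move=> hy; rewrite rec ?subC; last by lia.
  rewrite (F3 (y - b)) ?(F1 (y - b - m)); try by lia.
  have [yl|yl] := ltP y (X + b + 2 * m - e - c).
    by rewrite (G1 (y - m)) //; lia.
  by rewrite (G2 (y - m)) //; lia.
have G4 (y : int) : X + b + 2 * m - e <= y < X + b + 3 * m - e -> y < X + b + b -> u y = 3%N.
  move=> hy yb; rewrite rec ?subC; last by lia.
  rewrite (F4 (y - b)); try by lia.
  have [yl|yl] := ltP y (X + b + 2 * m).
    by rewrite (G2 (y - m)) ?(F2 (y - b - m)) //; lia.
  by rewrite (G3 (y - m)) ?(F3 (y - b - m)) //; lia.
have G5 (y : int) : X + b + 3 * m - e <= y < X + b + b ->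
    u (y - m) = 3%N \/ u (y - m) = 0%N -> (u y + u (y - m)%R)%N = 3%N.
  move=> hy um; rewrite rec ?subC; last by lia.
  case: um => ->; case: (FR (y - b) ltac:(lia)) (FR (y - b - m) ltac:(lia))
    (F5 (y - b) ltac:(lia)) => -> [] -> //; lia.
have GR (y : int) : X + b + 2 * m - e <= y < X + b + b -> u y = 3%N \/ u y = 0%N.
  move=> hy; apply: (@alternate_range u m (X + b + 2 * m - e) (X + b + b) 3%N) => // [|z hz zR|z hz um].
  - by lia.
  - by apply: G4; lia.
  by apply: G5 => //; lia.
have {}G5 (y : int) : X + b + 3 * m - e <= y < X + b + b -> (u y + u (y - m)%R)%N = 3%N.
  by move=> hy; apply: G5 => //; apply: GR; lia.
have GA := @alternate u m (X + b + 2 * m - e) (X + b + b) 3%N ltac:(lia) isT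
  ltac:(by move=> *; apply: G4; lia) ltac:(by move=> *; apply: G5; lia).
have H1 (y : int) : X + b + b - e - c <= y < X + b + b -> u y = 3%N.
  by move=> hy; apply: (GA q y _).1; lia.
have H2 (y : int) : X + b + b - m <= y < X + b + b - e - c -> u y = 0%N.
  case: q bE mq GA {FA E1 E2 H1} => [|k] bE mq GA hy; first by apply: G3; lia.
  by apply: (GA k y _).2; lia.
have GR' (y : int) : X + b + m <= y < X + b + b -> u y = 0%N \/ u y = 3%N.
  move=> hy; have [yl|yl] := ltP y (X + b + 2 * m - e); first by left; apply: G3; lia.
  by case: (GR y) => [|->|->]; [lia|right|left].
(* After [X], 1s occur only in the first half, and each is preceded by 1 or 2. *)
split; last first.
  move=> y hy; have [y1|y1] := ltP y (X + m - e); first by rewrite (F1 (y - 1)) //; lia.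
  have [y2|y2] := ltP y (X + m); first by rewrite F2 //; lia.
  have [y3|y3] := ltP y (X + 2 * m - e); first by rewrite F3 //; lia.
  have [y4|y4] := ltP y (X + b).
    have [->|ne] := eqVneq y (X + 2 * m - e); first by rewrite (F3 (X + 2 * m - e - 1)) //; lia.
    by case: (FR (y - 1)) => [|->|->] //; lia.
  have [y5|y5] := ltP y (X + b + m - e - c); first by rewrite G1 //; lia.
  have [y6|y6] := ltP y (X + b + m); first by rewrite G2 //; lia.
  by case: (GR' y) => [|->|->] //; lia.
split; split=> y hy.
- by apply: H2; lia.
- by apply: H1; lia.
- by right; apply: G1; lia.
- by apply: G2; lia.
- by rewrite E2 //; lia.
- by rewrite E1 //; lia.
- by apply: GR'; lia.
(* The required 0 comes from the run in [G3], and later from the alternation of 0 and 3 at distance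
   [m]. *)
move=> ye; have [yl|yl] := ltP y (X + b + 2 * m - e); first by left; apply: G3; lia.
have [y2|y2] := ltP y (X + b + 3 * m - e); first by right; apply: G3; lia.
by have := G5 y ltac:(lia); case: (GR y ltac:(lia)) => -> ?; [right; lia | left].
Qed.

(** Now a whole block of 1s ends at [X + b - f], and the alternation of 1 and 2 goes on for [m]
    entries past [X + b]. This accounts for the additional [m] in the row length. *)
Lemma row_start_next_ge (u : int -> nat) (m b c X e : int) (q : nat) :
  additive_nim u m b -> 0 < c < m -> b = 2 * m * q%:Z + 2 * m + c ->
  0 <= X -> 0 <= e < m -> m <= e + c -> row_start u m b X e ->
  row_start u m b (X + 2 * b + m) (e + c - m) /\
  (forall y : int, X < y < X + 2 * b + m -> u y = 1%N -> u (y - 1) <> 0%N).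
Proof.
move=> nim_u hc bE X0 he ec st.
have [f fE] : exists f, f = e + c - m by exists (e + c - m).
rewrite -fE; have {ec} hf : 0 <= f < e by lia.
have mq : 0 <= m * q%:Z by rewrite mulr_ge0 //; lia.
have [F1 F2 F3 F4 F5] := row_first_half (e := e) nim_u ltac:(lia) ltac:(lia) X0 ltac:(lia) st.
have subC (y : int) : y - m - b = y - b - m by lia.
case: nim_u st => _ rec [[p1 p2 _ _] _].
have FR (y : int) : X + 2 * m - e <= y < X + b -> u y = 1%N \/ u y = 2%N.
  move=> hy; apply: (@alternate_range u m (X + 2 * m - e) (X + b) 1%N) => // [|z hz zR|z hz um].
  - by lia.
  - by apply: F4; lia.
  by apply: F5 => //; lia.
have {}F5 (y : int) : X + 3 * m - e <= y < X + b -> (u y + u (y - m)%R)%N = 3%N.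
  by move=> hy; apply: F5 => //; apply: FR; lia.
have FA := @alternate u m (X + 2 * m - e) (X + b) 1%N ltac:(lia) isT
  ltac:(by move=> *; apply: F4; lia) ltac:(by move=> *; apply: F5; lia).
have E1 (y : int) : X + b - m - f <= y < X + b - f -> u y = 1%N.
  by move=> hy; apply: (FA q y _).1; lia.
have E2 (y : int) : X + b - f <= y < X + b -> u y = 2%N.
  by move=> hy; apply: (FA q y _).2; lia.
(* The option values are 1, 1, 0 and then 1, 0, 3, so the 2s continue across [X + b]. *)
have G1 (y : int) : X + b <= y < X + b + m - f -> u y = 2%N.
  move=> hy; rewrite rec; last by lia.
  rewrite (E1 (y - m)); last by lia.
  have [yl|yl] := ltP y (X + b + m - e).
    by rewrite (F1 (y - b)) ?(p1 (y - m - b)) //; lia.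
  by rewrite (F2 (y - b)) ?(p2 (y - m - b)) //; lia.
have G2 (y : int) : X + b + m - f <= y < X + b + m -> u y = 1%N.
  move=> hy; rewrite rec; last by lia.
  by rewrite (E2 (y - m)) ?(F2 (y - b)) ?(p2 (y - m - b)) //; lia.
have {}FR (y : int) : X + 2 * m - e <= y < X + b + m -> u y = 1%N \/ u y = 2%N.
  move=> hy; have [y1|y1] := ltP y (X + b); first by apply: FR; lia.
  have [y2|y2] := ltP y (X + b + m - f); first by right; apply: G1; lia.
  by left; apply: G2; lia.
have {}F5 (y : int) : X + 3 * m - e <= y < X + b + m -> (u y + u (y - m)%R)%N = 3%N.
  move=> hy; have [y1|y1] := ltP y (X + b); first by apply: F5; lia.
  have [y2|y2] := ltP y (X + b + m - f); first by rewrite G1 ?(E1 (y - m)) //; lia.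
  by rewrite G2 ?(E2 (y - m)) //; lia.
have K1 (y : int) : X + b + m <= y < X + b + 2 * m - e -> u y = 0%N.
  move=> hy; rewrite rec ?subC; last by lia.
  by rewrite (G1 (y - m)) ?(F3 (y - b)) ?(F1 (y - b - m)) //; lia.
have K2 (y : int) : X + b + 2 * m - e <= y < X + b + 2 * m - f -> u y = 3%N.
  move=> hy; rewrite rec ?subC; last by lia.
  by rewrite (G1 (y - m)) ?(F4 (y - b)) ?(F2 (y - b - m)) //; lia.
have K3 (y : int) : X + b + 2 * m - f <= y < X + b + 2 * m -> u y = 2%N.
  move=> hy; rewrite rec ?subC; last by lia.
  by rewrite (G2 (y - m)) ?(F4 (y - b)) ?(F2 (y - b - m)) //; lia.
have K4 (y : int) : X + b + 2 * m <= y < X + b + 3 * m - e -> u y = 3%N.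
  move=> hy; rewrite rec ?subC; last by lia.
  by rewrite (K1 (y - m)) ?(F4 (y - b)) ?(F3 (y - b - m)) //; lia.
have K5 (y : int) : X + b + 3 * m - e <= y < X + b + 4 * m - e -> y < X + b + m + b -> u y = 0%N.
  move=> hy yb; rewrite rec ?subC; last by lia.
  have F4' := F4 (y - b - m) ltac:(lia) ltac:(lia).
  have -> : u (y - b) = 2%N by have := F5 (y - b) ltac:(lia); rewrite F4'; lia.
  rewrite F4'.
  have [y1|y1] := ltP y (X + b + 3 * m - f); first by rewrite (K2 (y - m)) //; lia.
  have [y2|y2] := ltP y (X + b + 3 * m); first by rewrite (K3 (y - m)) //; lia.
  by rewrite (K4 (y - m)) //; lia.
have K6 (y : int) : X + b + 4 * m - e <= y < X + b + m + b ->
    u (y - m) = 0%N \/ u (y - m) = 3%N -> (u y + u (y - m)%R)%N = 3%N.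
  move=> hy um; rewrite rec ?subC; last by lia.
  case: um => ->; case: (FR (y - b) ltac:(lia)) (FR (y - b - m) ltac:(lia))
    (F5 (y - b) ltac:(lia)) => -> [] -> //; lia.
have KR (y : int) : X + b + 3 * m - e <= y < X + b + m + b -> u y = 0%N \/ u y = 3%N.
  move=> hy; apply: (@alternate_range u m (X + b + 3 * m - e) (X + b + m + b) 0%N) => // [|z hz zR|z hz um].
  - by lia.
  - by apply: K5; lia.
  by apply: K6 => //; lia.
have {}K6 (y : int) : X + b + 4 * m - e <= y < X + b + m + b -> (u y + u (y - m)%R)%N = 3%N.
  by move=> hy; apply: K6 => //; apply: KR; lia.
have KA := @alternate u m (X + b + 3 * m - e) (X + b + m + b) 0%N ltac:(lia) isT
  ltac:(by move=> *; apply: K5; lia) ltac:(by move=> *; apply: K6; lia).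
have H1 (y : int) : X + b + m + b - f <= y < X + b + m + b -> u y = 3%N.
  by move=> hy; apply: (KA q y _).2; lia.
have H2 (y : int) : X + b + b <= y < X + b + m + b - f -> u y = 0%N.
  by move=> hy; apply: (KA q y _).1; lia.
have KR' (y : int) : X + b + 2 * m <= y < X + b + m + b -> u y = 0%N \/ u y = 3%N.
  move=> hy; have [yl|yl] := ltP y (X + b + 3 * m - e); first by right; apply: K4; lia.
  by apply: KR; lia.
split; last first.
  move=> y hy; have [y1|y1] := ltP y (X + m - e); first by rewrite (F1 (y - 1)) //; lia.
  have [y2|y2] := ltP y (X + m); first by rewrite F2 //; lia.
  have [y3|y3] := ltP y (X + 2 * m - e); first by rewrite F3 //; lia.
  have [y4|y4] := ltP y (X + b + m).
    have [->|ne] := eqVneq y (X + 2 * m - e); first by rewrite (F3 (X + 2 * m - e - 1)) //; lia.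
    by case: (FR (y - 1)) => [|->|->] //; lia.
  have [y5|y5] := ltP y (X + b + 2 * m - e); first by rewrite K1 //; lia.
  have [y6|y6] := ltP y (X + b + 2 * m - f); first by rewrite K2 //; lia.
  have [y7|y7] := ltP y (X + b + 2 * m); first by rewrite K3 //; lia.
  by case: (KR' y) => [|->|->] //; lia.
split; split=> y hy.
- by apply: H2; lia.
- by apply: H1; lia.
- have [y1|y1] := ltP y (X + b + 2 * m - e); first by left; apply: K1; lia.
  by right; apply: K2; lia.
- by apply: K3; lia.
- by rewrite G1 //; lia.
- by rewrite G2 //; lia.
- by apply: KR'; lia.
move=> ye; have [yl|yl] := ltP y (X + b + 3 * m - e); first by right; apply: K1; lia.
have [y2|y2] := ltP y (X + b + 4 * m - e); first by left; apply: K5; lia.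
by have := K6 y ltac:(lia); case: (KR y ltac:(lia)) => -> ?; [left | right; lia].
Qed.

(** With [c <= 0] the offset stays 0. The last block of 2s needs [- c] entries past [X + b] to be
    complete, whence the row length [2 * b - c]. *)
Lemma row_start_next0 (u : int -> nat) (m b c X : int) (q : nat) :
  additive_nim u m b -> 0 < m -> - m <= c <= 0 -> b = 2 * m * q%:Z + 2 * m + c ->
  0 <= X -> row_start u m b X 0 ->
  row_start u m b (X + 2 * b - c) 0 /\
  (forall y : int, X < y < X + 2 * b - c -> u y = 1%N -> u (y - 1) <> 0%N).
Proof.
move=> nim_u m0 hc bE X0 st.
have mq : 0 <= m * q%:Z by rewrite mulr_ge0 //; lia.
have [F1 _ F3 F4 F5] := row_first_half (e := 0) nim_u ltac:(lia) ltac:(lia) X0 ltac:(lia) st.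
have subC (y : int) : y - m - b = y - b - m by lia.
case: nim_u st => _ rec [[p1 _ _ _] _].
(* For offset 0 the pieces of the first half merge into one alternation starting at [X]. *)
have {F3 F4}F5 (y : int) : X + m <= y < X + b -> u (y - m) = 1%N \/ u (y - m) = 2%N ->
    (u y + u (y - m)%R)%N = 3%N.
  move=> hy um; have [y2|y2] := ltP y (X + 2 * m).
    by rewrite F3 ?(F1 (y - m)) //; lia.
  have [y3|y3] := ltP y (X + 3 * m); first by rewrite F4 ?(F3 (y - m)) //; lia.
  by apply: F5 => //; lia.
have FR (y : int) : X <= y < X + b -> u y = 1%N \/ u y = 2%N.
  move=> hy; apply: (@alternate_range u m X (X + b) 1%N) => // z hz zR.
  by apply: F1; lia.
have {}F5 (y : int) : X + m <= y < X + b -> (u y + u (y - m)%R)%N = 3%N.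
  by move=> hy; apply: F5 => //; apply: FR; lia.
have FA := @alternate u m X (X + b) 1%N ltac:(lia) isT
  ltac:(by move=> *; apply: F1; lia) ltac:(by move=> *; apply: F5; lia).
have E1 (y : int) : X + b - c - 2 * m <= y < X + b - c - m -> u y = 1%N.
  by move=> hy; apply: (FA q y _).1; lia.
have G (y : int) : X + b <= y < X + b - c -> u y = 2%N.
  move=> hy; rewrite rec; last by lia.
  by rewrite (E1 (y - m)) ?(F1 (y - b)) ?(p1 (y - m - b)) //; lia.
have {}FR (y : int) : X <= y < X + b - c -> u y = 1%N \/ u y = 2%N.
  move=> hy; have [y1|y1] := ltP y (X + b); first by apply: FR; lia.
  by right; apply: G; lia.
have {}F5 (y : int) : X + m <= y < X + b - c -> (u y + u (y - m)%R)%N = 3%N.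
  move=> hy; have [y1|y1] := ltP y (X + b); first by apply: F5; lia.
  by rewrite G ?(E1 (y - m)) //; lia.
have E2 (y : int) : X + b - c - m <= y < X + b - c -> u y = 2%N.
  by move=> hy; have := F5 y ltac:(lia); rewrite (E1 (y - m)); lia.
have K1 (y : int) : X + b - c <= y < X + b + m -> u y = 3%N.
  move=> hy; rewrite rec; last by lia.
  by rewrite (E2 (y - m)) ?(F1 (y - b)) ?(p1 (y - m - b)) //; lia.
have K2 (y : int) : X + b + m <= y < X + b + 2 * m -> y < X + 2 * b - c -> u y = 0%N.
  move=> hy yb; rewrite rec ?subC; last by lia.
  have F1' := F1 (y - b - m) ltac:(lia).
  have -> : u (y - b) = 2%N by have := F5 (y - b) ltac:(lia); rewrite F1'; lia.
  rewrite F1'; have [y1|y1] := ltP y (X + b - c + m); first by rewrite (E2 (y - m)) //; lia.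
  by rewrite (K1 (y - m)) //; lia.
have K3 (y : int) : X + b + 2 * m <= y < X + 2 * b - c ->
    u (y - m) = 0%N \/ u (y - m) = 3%N -> (u y + u (y - m)%R)%N = 3%N.
  move=> hy um; rewrite rec ?subC; last by lia.
  case: um => ->; case: (FR (y - b) ltac:(lia)) (FR (y - b - m) ltac:(lia))
    (F5 (y - b) ltac:(lia)) => -> [] -> //; lia.
have KR (y : int) : X + b + m <= y < X + 2 * b - c -> u y = 0%N \/ u y = 3%N.
  move=> hy; apply: (@alternate_range u m (X + b + m) (X + 2 * b - c) 0%N) => // [z hz zR|z hz um].
    by apply: K2; lia.
  by apply: K3 => //; lia.
have {}K3 (y : int) : X + b + 2 * m <= y < X + 2 * b - c -> (u y + u (y - m)%R)%N = 3%N.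
  by move=> hy; apply: K3 => //; apply: KR; lia.
have KA := @alternate u m (X + b + m) (X + 2 * b - c) 0%N ltac:(lia) isT
  ltac:(by move=> *; apply: K2; lia) ltac:(by move=> *; apply: K3; lia).
have KR' (y : int) : X + b - c <= y < X + 2 * b - c -> u y = 0%N \/ u y = 3%N.
  move=> hy; have [y1|y1] := ltP y (X + b + m); first by right; apply: K1; lia.
  by apply: KR; lia.
split; last first.
  move=> y hy; have [y1|y1] := ltP y (X + b - c).
    by case: (FR (y - 1)) => [|->|->] //; lia.
  by case: (KR' y) => [|->|->] //; lia.
split; split=> y hy; try lia.
- by apply: (KA q y _).1; lia.
- by apply: KR'; lia.
- by rewrite E2 //; lia.
- by apply: KR'; lia.
move=> _; have [y2|y2] := ltP y (X + b + 2 * m); first by left; apply: K2; lia.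
by have := K3 y ltac:(lia); case: (KR y ltac:(lia)) => -> ?; [left | right; lia].
Qed.

(** * From rows to the least period *)

Lemma row_start_sink (u : int -> nat) (m b : int) :
  additive_nim u m b -> 0 < m -> m <= b -> row_start u m b 0 0.
Proof.
move=> [sink _] m0 mb.
by split; split=> y hy; try lia; try (by left; apply: sink; lia); rewrite sink //; lia.
Qed.

(** [row_start] does not fix all [m + b] preceding values, so the recurrence alone is not enough.
    The first [b] values are forced by [row_first_half]; later options reach back at most [m] before
    the start, where both sides are 0. *)
Lemma row_start_agree (u : int -> nat) (m b X Y : int) :
  additive_nim u m b -> 0 < m -> m <= b -> 0 <= X -> 0 <= Y ->
  row_start u m b X 0 -> row_start u m b Y 0 ->
  forall r : int, 0 <= r -> u (X + r) = u (Y + r).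
Proof.
move=> nim_u m0 mb X0 Y0 stX stY.
have row (Z : int) : 0 <= Z -> row_start u m b Z 0 ->
  [/\ forall y : int, Z <= y < Z + m -> u y = 1%N,
      forall y : int, Z + m <= y < Z + b -> (u y + u (y - m)%R)%N = 3%N
    & forall y : int, Z - m <= y < Z -> u y = 0%N].
  move=> Z0 stZ.
  have [F1 _ F3 F4 F5] := row_first_half (e := 0) nim_u m0 mb Z0 ltac:(lia) stZ.
  have flip (y : int) : Z + m <= y < Z + b -> u (y - m) = 1%N \/ u (y - m) = 2%N ->
      (u y + u (y - m)%R)%N = 3%N.
    move=> hy um; have [y2|y2] := ltP y (Z + 2 * m).
      by rewrite F3 ?(F1 (y - m)) //; lia.
    have [y3|y3] := ltP y (Z + 3 * m); first by rewrite F4 ?(F3 (y - m)) //; lia.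
    by apply: F5 => //; lia.
  split=> y hy; first by apply: F1; lia.
    apply: (flip) => //; apply: (@alternate_range u m Z (Z + b) 1%N _ _ _ flip) => //.
      by move=> z hz _; apply: F1; lia.
    by lia.
  by have [[p1 _ _ _] _] := stZ; apply: p1; lia.
have [[X1 X2 X3] [Y1 Y2 Y3]] := (row X X0 stX, row Y Y0 stY).
have [_ rec] := nim_u.
suff agree (n : nat) (r : int) : 0 <= r < n%:Z -> u (X + r) = u (Y + r).
  by move=> r r0; apply: (agree (absz r).+1); lia.
elim: n r => [|n IHn] r hr; first lia.
have {}IHn (s : int) : 0 < s <= r -> u (X + r - s) = u (Y + r - s).
  by move=> hs; rewrite -!addrA; apply: IHn; lia.
have [rm|rm] := ltP r m; first by rewrite X1 ?Y1 //; lia.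
have [rb|rb] := ltP r b.
  have := X2 (X + r) ltac:(lia); have := Y2 (Y + r) ltac:(lia); rewrite IHn; lia.
rewrite (rec (X + r)) ?(rec (Y + r)); try lia.
rewrite (IHn m ltac:(lia)) (IHn b ltac:(lia)); congr mex3.
have [rmb|rmb] := ltP r (m + b); first by rewrite X3 ?Y3 //; lia.
by have := IHn (m + b) ltac:(lia); rewrite !opprD !addrA.
Qed.

(** A period [q < P] would put [u q = u 0 = 1] right after [u (q - 1) = u (P - 1) = 0], a rise
    excluded before [P]. *)
Lemma row_start_period (u : int -> nat) (m b P : int) :
  additive_nim u m b -> 0 < m -> m <= b -> 0 < P -> row_start u m b P 0 ->
  (forall y : int, 0 < y < P -> u y = 1%N -> u (y - 1) <> 0%N) ->
  (forall r : int, 0 <= r -> u (r + P) = u r) /\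
  (forall q : int, 0 < q -> (forall r : int, 0 <= r -> u (r + q) = u r) -> P <= q).
Proof.
move=> nim_u m0 mb P0 stP norise.
have st0 := row_start_sink nim_u m0 mb.
have perP (r : int) : 0 <= r -> u (r + P) = u r.
  move=> r0; rewrite addrC -[in RHS](add0r r).
  by apply: (@row_start_agree u m b) => //; lia.
split=> // q q0 perq; have [//|qP] := leP P q.
have [F1 _ _ _ _] := row_first_half (X := 0) (e := 0) nim_u m0 mb ltac:(lia) ltac:(lia) st0.
case: (norise q); first lia.
  by rewrite -(add0r q) perq // F1 //; lia.
(* Periodicity holds only from 0 on, so [q - 1] is raised by [P] before [q] is taken off. *)
rewrite -perP; last lia.
have -> : q - 1 + P = P - 1 + q by lia.
have [[p1 _ _ _] _] := stP.
by rewrite perq ?p1 //; lia.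
Qed.

(** Each row adds [c] to the offset modulo [m], and each wrap-around comes with a row longer by [m];
    hence the [k * c %/ m] extra terms in [X]. *)
Lemma row_start_iter (u : int -> nat) (m b c : nat) (q : nat) :
  additive_nim u m b -> (0 < c < m)%N -> b = (2 * m * q + 2 * m + c)%N ->
  forall k : nat, (forall j, (0 < j < k)%N -> ~~ (m %| j * c)%N) ->
  let X := (2 * b * k + m * (k * c %/ m))%N in
  row_start u m b X (k * c %% m)%N /\
  (forall y : int, 0 < y < X%:Z -> u y = 1%N -> u (y - 1) <> 0%N).
Proof.
move=> nim_u hc bE; elim=> [_|k IHk ndvd] /=.
  rewrite mul0n mod0n div0n !muln0; split=> [|y]; last lia.
  by apply: row_start_sink nim_u _ _; lia.
have [|st norise] := IHk; first by move=> j hj; apply: ndvd; lia.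
set t := (k * c %/ m)%N in st norise; set e := (k * c %% m)%N in st norise.
have em : (e < m)%N by apply: ltn_pmod; lia.
set X := (2 * b * k + m * t)%N in st norise.
have kcE : (k.+1 * c = t * m + (e + c))%N by rewrite mulSn addnC addnA -divn_eq.
have norise' (Y : nat) : (X <= Y)%N ->
    (forall y : int, X%:Z < y < Y%:Z -> u y = 1%N -> u (y - 1) <> 0%N) ->
    forall y : int, 0 < y < Y%:Z -> u y = 1%N -> u (y - 1) <> 0%N.
  move=> XY norise2 y hy; have [yX|yX] := ltP y X%:Z; first by apply: norise; lia.
  (* The junction [y = X] is covered by neither row. There [k > 0] because [y > 0], so the offset is
     nonzero and the value just before [X] is 3. *)
  have [yE _|yX'] := eqVneq y X%:Z; last by apply: norise2; lia.
  have k0 : (0 < k)%N.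
    by rewrite lt0n; apply/eqP => k0; move: hy; rewrite yE /X /t k0 mul0n div0n !muln0; lia.
  have e0 : (0 < e)%N by rewrite lt0n; apply: ndvd; lia.
  by have [[_ p2 _ _] _] := st; rewrite p2 //; lia.
rewrite kcE modnMDl divnMDl; last lia.
have [ec|ec] := ltnP (e + c) m.
  rewrite divn_small // modn_small // addn0.
  have [st2 nr2] := @row_start_next_lt u m b c X e q nim_u ltac:(lia) ltac:(lia) ltac:(lia)
    ltac:(lia) ltac:(lia) st.
  have XE : (2 * b * k.+1 + m * t)%N = X%:Z + 2 * b%:Z :> int by rewrite /X; lia.
  split; first by rewrite XE PoszD.
  by apply: norise' => [|y hy]; [lia | apply: nr2; lia].
have -> : (e + c = 1 * m + (e + c - m))%N by lia.
rewrite modnMDl divnMDl ?divn_small ?modn_small; try lia.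
have [st2 nr2] := @row_start_next_ge u m b c X e q nim_u ltac:(lia) ltac:(lia) ltac:(lia)
  ltac:(lia) ltac:(lia) st.
have XE : (2 * b * k.+1 + m * (t + (1 + 0)))%N = X%:Z + 2 * b%:Z + m%:Z :> int.
  by rewrite /X; lia.
split.
  rewrite XE; have -> : Posz (e + c - m) = e%:Z + c%:Z - m%:Z by lia.
  exact: st2.
by apply: norise' => [|y hy]; [lia | apply: nr2; lia].
Qed.

(** * Back to nim-values, and the arithmetic of the period *)

Lemma nim_value_additive (m delta : nat) : (0 < m)%N ->
  additive_nim (fun y => nim_value (additive_set m delta) (y + 1)) m (m + delta)%N.
Proof.
move=> m0; split=> y hy; first by apply: nim_value_sink; lia.
rewrite nim_valueE; last lia.
  rewrite -mex3E /=; congr (mex [:: nim_value _ _; nim_value _ _; nim_value _ _]); lia.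
by rewrite !inE; lia.
Qed.

Theorem theorem3 (m delta : nat) (hm : (0 < m)%N) (hdelta : (0 < delta)%N) :
  let d := (delta %% (2 * m))%N in
  purely_periodic_with_length (nim_value (additive_set m delta))
    (if (d <= m)%N then (3 * m + 2 * delta - d)%N
     else ((m * (m + 2 * delta + d)) %/ gcdn m d)%N).
Proof.
set d := (delta %% (2 * m))%N => /=; set P := if _ then _ else _.
set u := fun y : int => nim_value (additive_set m delta) (y + 1).
have nim_u : additive_nim u m (m + delta)%N by exact: nim_value_additive.
suff [P0 st norise] : [/\ (0 < P)%N, row_start u m (m + delta)%N P 0
    & forall y : int, 0 < y < P%:Z -> u y = 1%N -> u (y - 1) <> 0%N].
  have [|||perP minP] := row_start_period nim_u _ _ _ st norise; try lia.
  split=> [|r [r0 perr]]; first split=> // x x1.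
    by have := perP (x - 1) ltac:(lia); rewrite /u addrAC subrK.
  suff: P%:Z <= r%:Z by lia.
  apply: minP => [|y y0]; first lia.
  by rewrite /u addrAC perr //; lia.
have dm : (d < 2 * m)%N by rewrite ltn_pmod //; lia.
have deltaE : (delta = delta %/ (2 * m) * (2 * m) + d)%N by exact: divn_eq.
set q := (delta %/ (2 * m))%N in deltaE.
rewrite /P; have [dm'|dm'] := leqP d m.
  have st0 : row_start u m (m + delta)%N 0 0 by apply: (row_start_sink nim_u); lia.
  (* Since [m + delta = 2 * m * q + 2 * m + (d - m)], the parameter [c] is [d - m], and one row is a
     full period. *)
  have [||||st norise] := @row_start_next0 u m (m + delta)%N (d%:Z - m%:Z) 0 q nim_u _ _ _ _ st0;
    try lia.
  have PE : Posz (3 * m + 2 * delta - d) = 0 + 2 * (m + delta)%N%:Z - (d%:Z - m%:Z) by lia.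
  by split; [lia | rewrite PE | rewrite PE].
set c := (d - m)%N; have dE : d = (m + c)%N by lia.
have gE : gcdn m d = gcdn m c by rewrite dE gcdnDl.
set g := gcdn m c in gE; have g0 : (0 < g)%N by rewrite gcdn_gt0 hm.
have [m' mE] : exists m', m = (m' * g)%N by exists (m %/ g)%N; rewrite divnK // dvdn_gcdl.
have [c' cE] : exists c', c = (c' * g)%N by exists (c %/ g)%N; rewrite divnK // dvdn_gcdr.
have cop : coprime m' c' by move/eqP: (erefl g); rewrite {1}/g mE cE -muln_gcdl; nia.
have kcE : (m' * c = c' * m)%N by rewrite mE cE mulnCA mulnA mulnAC; lia.
(* The period consists of [m'] rows, [c'] of which are longer by [m]. *)
have PE : (m * (m + 2 * delta + d) %/ gcdn m d =
    2 * (m + delta) * m' + m * (m' * c %/ m))%N.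
  rewrite gE kcE mulnK // (_ : (m + 2 * delta + d = 2 * (m + delta) + c)%N); last lia.
  by rewrite {1}mE mulnAC mulnK // mulnDr kcE [(c' * m)%N]mulnC [(m' * _)%N]mulnC.
have [|st norise] := @row_start_iter u m (m + delta) c q nim_u ltac:(lia) ltac:(lia) m'.
  (* By coprimality [m] divides [j * c] only if [m'] divides [j], so the offset does not return to 0
     earlier. *)
  move=> j hj; rewrite mE cE mulnA dvdn_pmul2r // Gauss_dvdl //.
  by apply/negP => /dvdn_leq; lia.
rewrite PE; split=> //.
  have m'0 : (0 < m')%N by case: (m') mE => // m0; rewrite m0 in hm.
  by apply: ltn_addr; rewrite !muln_gt0 m'0 addn_gt0 hm.
by move: st; rewrite kcE modnMl.
Qed.
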